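(* Let $V \in \mathbb{R}^{m\times n}$, $m < n$, be such that $V^{\mathsf T} \in \mathrm{SC}_m$, $\Delta(V^{\mathsf T}) \in \mathrm{VB}_{m-1}$ and $\det(V_{(:,(1:m))}) \neq 0$. Then the vector $p \in \mathbb{R}^n$ defined by $$p_k := \|V_{(:,(1:m))}^{-1} V_{(:,\{k\})}\|_{\ell_1}, \quad k \in \{1,\dots,n\},$$ is unimodal.
   Context: $V_{(:,(1:m))}$ denotes the submatrix of the first $m$ columns of $V$ and $V_{(:,\{k\})}$ its $k$-th column; $\|x\|_{\ell_1} = \sum_i|x_i|$. A matrix $X$ is $k$-sign consistent ($X\in\mathrm{SC}_k$) if all its minors of order $k$ are $\geq 0$ or all its minors of order $k$ are $\leq 0$. For $X\in\mathbb{R}^{n\times m}$, the row forward difference $\Delta X\in\mathbb{R}^{(n-1)\times m}$ is the matrix whose $i$-th row is (row $i+1$ of $X$) minus (row $i$ of $X$). The variation $\mathrm{S}(u)$ of a vector $u\neq 0$ is the number of sign changes in the sequence obtained by deleting all zero entries of $u$, i.e. the number of consecutive pairs of remaining entries with negative product; $\mathrm{S}(0) := -1$. A matrix $X\in\mathbb{R}^{n\times m}$ is $k$-variation bounding ($X\in\mathrm{VB}_k$), $0\leq k\leq\min\{m-1,n-1\}$, if for all $u\in\mathbb{R}^m$ with $\mathrm{S}(u)\leq k$ it holds that $\mathrm{S}(Xu)\leq k$. A vector $a\in\mathbb{R}^n$ with $a\geq 0$ is unimodal if there is an $l\in\{1,\dots,n\}$ such that $a_1\leq\dots\leq a_l\geq\dots\geq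 a_n$. *)

(* Defs.v *)
From mathcomp Require Import all_boot all_order all_algebra.
From mathcomp Require Import reals.

Set Implicit Arguments.
Unset Strict Implicit.
Unset Printing Implicit Defensive.

Import Order.TTheory GRing.Theory Num.Theory.
Local Open Scope ring_scope.

(* A minor of order k is the determinant of the submatrix extracted by strictly
   increasing row and column selections. *)
Definition sign_consistent (R : realType) (n m k : nat) (X : 'M[R]_(n, m)) :
    Prop :=
  (forall (f : 'I_k -> 'I_n) (g : 'I_k -> 'I_m),
      {homo f : i j / (i < j)%N} -> {homo g : i j / (i < j)%N} ->
      0 <= \det (mxsub f g X)) \/
  (forall (f : 'I_k -> 'I_n) (g : 'I_k -> 'I_m),
      {homo f : i j / (i < j)%N} -> {homo g : i j / (i < j)%N} ->
      \det (mxsub f g X) <= 0).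

Definition ord_this (n : nat) (i : 'I_n.-1) : 'I_n := widen_ord (leq_pred n) i.

Lemma ord_next_subproof (n : nat) (i : 'I_n.-1) : (i.+1 < n)%N.
Proof. by rewrite -ltn_predRL. Qed.

Definition ord_next (n : nat) (i : 'I_n.-1) : 'I_n :=
  Ordinal (ord_next_subproof i).

Definition row_diff (R : realType) (n m : nat) (X : 'M[R]_(n, m)) :
    'M[R]_(n.-1, m) :=
  \matrix_(i < n.-1, j < m) (X (ord_next i) j - X (ord_this i) j).

Definition sign_changes (R : realType) (s : seq R) : nat :=
  let t := [seq x <- s | x != 0] in
  count (fun xy : R * R => xy.1 * xy.2 < 0) (zip t (behead t)).

Definition variation (R : realType) (n : nat) (u : 'cV[R]_n) : int :=
  if u == 0 then -1
  else (sign_changes [seq u i 0 | i <- enum 'I_n])%:Z.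

(* The bounds k < m and k < n encode 0 <= k <= min {m - 1, n - 1} without
   truncated subtraction. In particular an instance with k = m.-1 forces
   0 < m. *)
Definition variation_bounding (R : realType) (n m k : nat)
    (X : 'M[R]_(n, m)) : Prop :=
  [/\ (k < m)%N, (k < n)%N &
      forall u : 'cV[R]_m, variation u <= k%:Z -> variation (X *m u) <= k%:Z].

Definition first_cols (R : realType) (m n : nat) (le_mn : (m <= n)%N)
    (V : 'M[R]_(m, n)) : 'M[R]_m :=
  colsub (widen_ord le_mn) V.

Definition l1norm (R : realType) (n : nat) (x : 'cV[R]_n) : R :=
  \sum_(i < n) `|x i 0|.

Definition unimodal (R : realType) (n : nat) (a : 'cV[R]_n) : Prop :=
  (forall i : 'I_n, 0 <= a i 0) /\
  exists l : 'I_n,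
    (forall i j : 'I_n, (i <= j)%N -> (j <= l)%N -> a i 0 <= a j 0) /\
    (forall i j : 'I_n, (l <= i)%N -> (i <= j)%N -> a j 0 <= a i 0).

(* Main.v *)
Require Import Defs.
From mathcomp Require Import all_boot all_order all_algebra.
From mathcomp Require Import reals.
From mathcomp Require Import zify lra.

Set Implicit Arguments.
Unset Strict Implicit.
Unset Printing Implicit Defensive.

Import Order.TTheory GRing.Theory Num.Theory.
Local Open Scope ring_scope.

(** Write [M] for the first [m] columns of [V] and [W = M^-1 V].  By Cramer's
    rule and sign consistency, [(-1)^(m-1-i) W_ik >= 0] for [k >= m] (indices
    from 0), so there [p_k] equals [q_k = sum_i (-1)^(m-1-i) W_ik], while
    [q_k = (-1)^(m-1-k)] and [p_k = 1] for [k < m].  As [q = V^T u] for some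
    [u], the differences of [q] change sign at most [m - 1] times.  The first
    [m - 1] of them alternate and end with a positive one, so a descent of [p]
    followed by an ascent would bring the number of sign changes to [m]. *)

(** Induction on [s], matching [t] greedily. Here [x] is the entry of the sequence just read and [y]
    the last matched entry of the alternating path; the invariant asks only that they share a
    sign. *)
Lemma count_sign_changes_path (R : realDomainType) (x y : R) (s t : seq R) :
  0 < x * y -> all (fun z => z != 0) s ->
  path (fun a b => a * b < 0) y t -> subseq t s ->
  (size t <= count (fun ab : R * R => ab.1 * ab.2 < 0)%R (zip (x :: s) s))%N.
Proof.
elim: s x y t => [|z s IH] x y [|w t] xy_gt0 //=.
case/andP=> z_neq0 s_neq0 /andP[yw_lt0 path_t].
have zz_gt0 : 0 < z * z by rewrite -expr2 exprn_even_gt0 //= z_neq0 orbT.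
case: eqP => [wz|_] sub_t.
  have -> : x * z < 0 by rewrite -wz; nra.
  by rewrite add1n ltnS; apply: (IH z w) => //; rewrite wz.
(* If [z] changes the sign, it already has the sign of [w], so [w] counts as matched at [z] even if
   it occurs later in [s]. *)
have [xz_lt0|xz_ge0] := ltP (x * z) 0.
  rewrite add1n ltnS; apply: (IH z w) => //; first by nra.
  exact: cons_subseq sub_t.
have x_neq0 : x != 0 by apply: contraTneq xy_gt0 => ->; rewrite mul0r ltxx.
have xz_gt0 : 0 < x * z by rewrite lt_def mulf_neq0.
rewrite add0n; apply: (IH z y (w :: t)) => //=; first by nra.
by rewrite yw_lt0.
Qed.

Lemma sign_changes_alternating (R : realType) (y : R) (s t : seq R) :
  y != 0 -> all (fun z => z != 0) t -> path (fun a b => a * b < 0) y t ->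
  subseq (y :: t) s -> (size t <= sign_changes s)%N.
Proof.
move=> y_neq0 t_neq0 path_t sub_t; rewrite /sign_changes.
have : subseq (y :: t) [seq x <- s | x != 0].
  by rewrite subseq_filter /= y_neq0 t_neq0.
have : all (fun z => z != 0) [seq x <- s | x != 0] by exact: filter_all.
case: [seq x <- s | x != 0] => [|x s'] //= /andP[x_neq0 s'_neq0].
have xx_gt0 : 0 < x * x by rewrite -expr2 exprn_even_gt0 //= x_neq0 orbT.
case: eqP => [yx|_] sub_s'.
  by apply: (@count_sign_changes_path _ x y) => //; rewrite yx.
have [xy_lt0|xy_ge0] := ltP (x * y) 0.
  (* The first nonzero entry [x] is opposite in sign to [y], so all of [y :: t] alternates starting
     from [x], one sign change more than required. *)
  apply: ltnW; apply: (@count_sign_changes_path _ x x s' (y :: t)) => //=.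
  by rewrite xy_lt0.
apply: (@count_sign_changes_path _ x y) => //; last exact: cons_subseq sub_s'.
by rewrite lt_def mulf_neq0.
Qed.

(** For a natural bound [k], the value -1 at the zero vector and the count 0 pass the same test. *)
Lemma variation_le (R : realType) (n : nat) (u : 'cV[R]_n) (k : nat) :
  (variation u <= k%:Z) = (sign_changes [seq u i 0%R | i <- enum 'I_n] <= k)%N.
Proof.
rewrite /variation; case: eqP => [->|_] //.
suff -> : sign_changes [seq (0 : 'cV[R]_n) i 0 | i <- enum 'I_n] = 0%N by [].
rewrite /sign_changes (_ : [seq x <- _ | x != 0] = [::]) //.
by elim: (enum 'I_n) => //= i s ->; rewrite mxE eqxx.
Qed.

(** At most [n] nonzero entries leave at most [n.-1] adjacent pairs. This makes the variation
    bounding hypothesis applicable to any vector of coefficients. *)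
Lemma variation_le_pred (R : realType) (n : nat) (u : 'cV[R]_n) :
  variation u <= n.-1%:Z.
Proof.
rewrite variation_le /sign_changes; apply: leq_trans (count_size _ _) _.
rewrite size_zip size_behead geq_min size_filter.
apply/orP; right; rewrite -!subn1 leq_sub2r //.
by apply: leq_trans (count_size _ _) _; rewrite size_map size_enum_ord.
Qed.

Lemma row_diff_mul (R : realType) (n m k : nat)
    (X : 'M[R]_(n, m)) (Y : 'M[R]_(m, k)) :
  row_diff X *m Y = row_diff (X *m Y).
Proof.
apply/matrixP => i j; rewrite !mxE -sumrB; apply: eq_bigr => l _.
by rewrite mxE mulrBl.
Qed.

Lemma unimodal_no_valley (R : realType) (n : nat) (a : 'cV[R]_n.+1)
    (p := fun k : nat => a (inord k) 0) :
  (forall i, 0 <= a i 0) ->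
  (forall i j, (i < j < n)%N -> p i.+1 < p i -> p j.+1 <= p j) ->
  unimodal a.
Proof.
move=> a_ge0 no_valley; split=> //.
have aE (i : 'I_n.+1) : a i 0 = p i by rewrite /p inord_val.
(* The peak is the start of the first descent, or the last index [n] if there is none. *)
have exP : exists l, (l == n) || (p l.+1 < p l) by exists n; rewrite eqxx.
have l_le : (ex_minn exP <= n)%N by case: ex_minnP => l _; apply; rewrite eqxx.
exists (inord (ex_minn exP)); rewrite inordK ?ltnS //.
case: ex_minnP l_le => l lP l_min l_le; split=> i j.
  rewrite !aE => le_ij le_jl; rewrite -(subnKC le_ij).
  have: (i + (j - i) <= l)%N by rewrite subnKC.
  elim: (j - i)%N => [|k IH] ltl; first by rewrite addn0.
  rewrite addnS in ltl *; apply: le_trans (IH (ltnW ltl)) _.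
  rewrite leNgt; apply/negP => desc.
  by have := l_min (i + k)%N; rewrite desc orbT => /(_ isT); rewrite leqNgt ltl.
rewrite !aE => le_li le_ij; rewrite -(subnKC le_ij).
have: (i + (j - i) <= n)%N by rewrite subnKC // -ltnS.
elim: (j - i)%N => [|k IH] ltn; first by rewrite addn0.
rewrite addnS in ltn *; apply: le_trans (IH (ltnW ltn)).
case/orP: lP => [/eqP l_eq|desc]; first by lia.
have [->|neq] := eqVneq (i + k)%N l; first exact: ltW.
by apply: (no_valley l) => //; lia.
Qed.

(* Both sides are expanded along the column [v]; deleting it leaves the same
   minors of [M]. *)
Lemma adj_mul_col_det (R : comNzRingType) (m : nat) (M N : 'M[R]_m.+1)
    (v : 'cV[R]_m.+1) (i : 'I_m.+1) :
  col ord_max N = v -> col' ord_max N = col' i M ->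
  \det N = (-1) ^+ (m + i) * (\adj M *m v) i 0.
Proof.
move=> Nv NM; rewrite (expand_det_col _ ord_max) mxE mulr_sumr.
apply: eq_bigr => j _; rewrite !mxE /cofactor -NM -Nv mxE /=.
rewrite mulrC !mulrA -exprD; congr (_ * _ * _).
have -> : (m + i + (j + i) = j + m + i * 2)%N by lia.
by rewrite [RHS]exprD exprM sqrr_sign mulr1.
Qed.

(** By Cramer's rule the signed coordinate is a quotient of two maximal minors of [V], and sign
    consistency gives these a common sign. *)
Lemma sign_consistent_coord_sign (R : realType) (m n : nat)
    (le_mn : (m.+1 <= n)%N) (V : 'M[R]_(m.+1, n)) (i : 'I_m.+1) (k : 'I_n) :
  sign_consistent m.+1 V^T -> \det (first_cols le_mn V) != 0 -> (m < k)%N ->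
  0 <= (-1) ^+ (m + i) * (invmx (first_cols le_mn V) *m col k V) i 0.
Proof.
set M := first_cols _ _ => hSC hdet lt_mk.
(* [g] lists the columns of [M] without the [i]-th and then column [k]; it is increasing because
   [m < k]. *)
pose g (j : 'I_m.+1) : 'I_n :=
  if unlift ord_max j is Some j' then widen_ord le_mn (lift i j') else k.
have g_homo : {homo g : a b / (a < b)%N}.
  move=> a b; rewrite /g.
  case: (unliftP ord_max a) => [a' ->|->];
    case: (unliftP ord_max b) => [b' ->|->].
  - by rewrite /= /bump; have := ltn_ord a'; have := ltn_ord b'; lia.
  - by rewrite /= /bump; have := ltn_ord a'; lia.
  - by rewrite /= /bump; have /= := ltn_ord b'; lia.
  - by rewrite ltnn.
have detE : \det (colsub g V) = (-1) ^+ (m + i) * (\adj M *m col k V) i 0.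
  apply: adj_mul_col_det; apply/matrixP => a b; rewrite !mxE /g.
    by rewrite unlift_none.
  by rewrite liftK.
have -> : (invmx M *m col k V) i 0 = (\det M)^-1 * (\adj M *m col k V) i 0.
  by rewrite /invmx unitmxE unitfE hdet -scalemxAl mxE.
rewrite mulrCA -detE.
have trE f : \det (mxsub f id V^T) = \det (colsub f V).
  by rewrite -det_tr; congr (\det _); apply/matrixP => a b; rewrite !mxE.
have w_homo : {homo widen_ord le_mn : a b / (a < b)%N} by [].
have id_homo : {homo (@id 'I_m.+1) : a b / (a < b)%N} by [].
case: hSC => hS.
  have := hS _ _ g_homo id_homo; have := hS _ _ w_homo id_homo.
  by rewrite !trE => M_ge0 N_ge0; rewrite mulr_ge0 ?invr_ge0.
have := hS _ _ g_homo id_homo; have := hS _ _ w_homo id_homo.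
by rewrite !trE => M_le0 N_le0; rewrite mulr_le0 ?invr_le0.
Qed.

Lemma sign_changes_alternating_start (R : realType) (m N a b : nat)
    (d : nat -> R) :
  (forall j, (j < m)%N -> 0 < (-1) ^+ (m + j).+1 * d j) ->
  (m <= a < b)%N -> (b < N)%N -> d a < 0 -> 0 < d b ->
  (m < sign_changes [seq d j | j <- iota 0 N])%N.
Proof.
move=> d_alt /andP[le_ma lt_ab] lt_bN da db.
(* On these [m.+2] indices [d] alternates: the initial signs end with a positive one at [m - 1],
   then come [d a < 0] and [d b > 0]. *)
pose J := iota 0 m ++ [:: a; b].
have nthJ j : (j < m)%N -> nth 0%N J j = j.
  by move=> ltjm; rewrite nth_cat size_iota ltjm nth_iota.
have nthJm : nth 0%N J m = a by rewrite nth_cat size_iota ltnn subnn.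
have nthJm1 : nth 0%N J m.+1 = b.
  by rewrite nth_cat size_iota ltnNge leqnSn subSnn.
have sizeJ : size J = m.+2 by rewrite size_cat size_iota addn2.
have subJ : subseq J (iota 0 N).
  (* Cutting [iota 0 N] at [m] and just after [a] puts the three pieces of [J] into separate
     blocks. *)
  rewrite (_ : N = m + ((a - m).+1 + ((b - a.+1).+1 + (N - b.+1))))%N;
    last by lia.
  rewrite iotaD; apply: cat_subseq => //.
  rewrite iotaD -[[:: a; b]]/([:: a] ++ [:: b]); apply: cat_subseq.
    by rewrite sub1seq mem_iota; lia.
  by rewrite sub1seq mem_iota; lia.
have altJ : sorted (fun x y => x * y < 0) (map d J).
  apply/(sortedP 0) => j; rewrite size_map sizeJ => ltj.
  rewrite !(nth_map 0%N) ?sizeJ //; try by lia.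
  have [jm1|jm1|jm1] := ltngtP j.+1 m.
  - rewrite !nthJ; try by lia.
    have := d_alt j.+1 jm1; have := d_alt j (ltnW jm1).
    rewrite addnS [in X in _ -> X]exprS.
    have: (-1) ^+ (m + j).+1 * (-1) ^+ (m + j).+1 = 1 :> R.
      by rewrite -expr2 sqrr_sign.
    by move: (_ ^+ _) => e; nra.
  - have -> : j = m by lia.
    by rewrite nthJm nthJm1; nra.
  - rewrite jm1 nthJm nthJ; last by lia.
    have := d_alt j; rewrite -jm1 ltnSn => /(_ isT).
    rewrite -addnS addnn -signr_odd odd_double expr0 mul1r => dj.
    by nra.
have J_neq0 : all (fun x => x != 0) (map d J).
  rewrite map_cat all_cat /= (lt_eqF da) (gt_eqF db) !andbT.
  apply/allP => _ /mapP[j + ->]; rewrite mem_iota => /andP[_ ltjm].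
  by have := d_alt j ltjm; apply: contraTneq => ->; rewrite mulr0 ltxx.
have := map_subseq d subJ; have : size (map d J) = m.+2 by rewrite size_map.
case: (map d J) altJ J_neq0 => [|y t] //= alt_t /andP[y_neq0 t_neq0] [size_t].
by move=> /(sign_changes_alternating y_neq0 t_neq0 alt_t); rewrite size_t.
Qed.

Theorem theorem4 (R : realType) (m n : nat) (lt_mn : (m < n)%N)
    (V : 'M[R]_(m, n))
    (hSC : sign_consistent m V^T)
    (hVB : variation_bounding m.-1 (row_diff V^T))
    (hdet : \det (first_cols (ltnW lt_mn) V) != 0) :
  unimodal (\col_(k < n)
    l1norm (invmx (first_cols (ltnW lt_mn) V) *m col k V)).
Proof.
case: hVB => m_gt0 _ /=.
(* From here [V] is [m.+1] by [n.+1], so the last column of [M] has index [m]. The exponent [m + i]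
   has the parity of [m - i] and avoids truncated subtraction. *)
case: m m_gt0 lt_mn V hSC hdet => // m _; case: n => // n lt_mn V hSC hdet hVB.
set M := first_cols _ _ in hdet *.
have M_unit : M \in unitmx by rewrite unitmxE unitfE.
pose s : 'rV[R]_m.+1 := \row_i (-1) ^+ (m + i).
pose q : 'cV[R]_n.+1 := V^T *m (s *m invmx M)^T.
have qE k : q k 0 = \sum_(i < m.+1) (-1) ^+ (m + i) * (invmx M *m col k V) i 0.
  have -> : q = (s *m (invmx M *m V))^T by rewrite mulmxA trmx_mul.
  rewrite mxE mxE; apply: eq_bigr => i _; rewrite [s _ _]mxE; congr (_ * _).
  by rewrite !mxE; apply: eq_bigr => j _; rewrite !mxE.
have coord_lt (k : 'I_n.+1) (lt_km : (k < m.+1)%N) :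
    invmx M *m col k V = col (Ordinal lt_km) 1%:M.
  have -> : col k V = col (Ordinal lt_km) M.
    by apply/matrixP => a b; rewrite !mxE; congr (V _ _); apply: val_inj.
  by rewrite -(mulVmx M_unit) !colE mulmxA.
have q_lt (k : 'I_n.+1) : (k <= m)%N -> q k 0 = (-1) ^+ (m + k).
  rewrite -ltnS => lt_km; rewrite qE (coord_lt k lt_km).
  rewrite (bigD1 (Ordinal lt_km)) //= big1 ?addr0.
    by rewrite !mxE eqxx mulr1.
  by move=> i /negPf i_neq; rewrite !mxE i_neq mulr0.
have p_lt (k : 'I_n.+1) : (k <= m)%N -> l1norm (invmx M *m col k V) = 1.
  rewrite -ltnS => lt_km; rewrite /l1norm (coord_lt k lt_km).
  rewrite (bigD1 (Ordinal lt_km)) //= big1 ?addr0.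
    by rewrite !mxE eqxx normr1.
  by move=> i /negPf i_neq; rewrite !mxE i_neq normr0.
(* Column [m] still belongs to [M], but there [q] is an even power of -1, so [p] and [q] agree
   already; a descent of [p] starting at [m] is thus one of [q]. *)
have p_ge (k : 'I_n.+1) : (m <= k)%N -> l1norm (invmx M *m col k V) = q k 0.
  rewrite leq_eqVlt => /orP[/eqP mk|lt_mk].
    by rewrite p_lt ?q_lt -?mk // addnn -signr_odd odd_double.
  rewrite qE; apply: eq_bigr => i _.
  have := sign_consistent_coord_sign i hSC hdet lt_mk => /ger0_norm <-.
  by rewrite normrM normrX normrN1 expr1n mul1r.
apply: unimodal_no_valley => [k|a b /andP[lt_ab lt_bn]].
  by rewrite mxE sumr_ge0.
rewrite !mxE => desc; have lt_an := ltn_trans lt_ab lt_bn.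
(* [p] is constantly 1 up to index [m], so no descent starts earlier. *)
have le_ma : (m <= a)%N.
  rewrite leqNgt; apply/negP => lt_am; move: desc.
  by rewrite !p_lt ?ltxx // inordK //; lia.
rewrite leNgt; apply/negP => asc; move: desc asc.
rewrite !p_ge ?inordK //; try by lia.
move=> desc asc.
pose d j := q (inord j.+1) 0 - q (inord j) 0.
have := hVB (s *m invmx M)^T (variation_le_pred _).
rewrite row_diff_mul -/q variation_le.
have -> : [seq row_diff q i 0 | i <- enum 'I_n] = [seq d j | j <- iota 0 n].
  rewrite -val_enum_ord -map_comp; apply: eq_map => i /=; rewrite mxE /d.
  have lt_in : (i < n)%N := ltn_ord i.
  by congr (q _ 0 - q _ 0); apply: val_inj; rewrite /= inordK // ltnS ltnW.
apply/negP; rewrite -ltnNge.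
apply: (sign_changes_alternating_start (a := a) (b := b));
  rewrite ?le_ma ?subr_lt0 ?subr_gt0 //.
(* For [j < m] both values of [q] are opposite signs, and the signed difference is 1 + 1. *)
move=> j lt_jm; rewrite /d !q_lt ?inordK; try by lia.
by rewrite addnS exprS mulN1r -opprD mulrNN mulrDr -expr2 sqrr_sign addr_gt0.
Qed.
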